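(* Let $B$ be a translation invariant differentiation basis in $\mathbb{R}^2$. Then every $W_B$-set $E\subset\Gamma_2$ is a set of type $G_{\delta\sigma}$ in $\Gamma_2$.
   Context: A differentiation basis in $\mathbb{R}^n$ is a mapping $B$ assigning to each $x\in\mathbb{R}^n$ a family $B(x)$ of bounded measurable sets of positive Lebesgue measure containing $x$, such that there is a sequence $R_k\in B(x)$ with $\operatorname{diam}R_k\to 0$. $B$ is translation invariant if $B(x)=\{x+R: R\in B(0)\}$ for every $x$. For $f\in L(\mathbb{R}^n)$ the upper and lower derivatives of $\int f$ at $x$ with respect to $B$ are $\overline{D}_B(\int f,x)=\limsup_{R\in B(x),\,\operatorname{diam}R\to0}\frac{1}{|R|}\int_R f$ and $\underline{D}_B(\int f,x)=\liminf_{R\in B(x),\,\operatorname{diam}R\to0}\frac{1}{|R|}\int_R f$; $B$ differentiates $\int f$ if both equal $f(x)$ for almost every $x$. $F_B$ denotes the class of $f\in L(\mathbb{R}^n)$ whose integrals are differentiated by $B$. $\Gamma_2$ is the set of rotations of $\mathbb{R}^2$ about the origin, identified with the unit circle $\mathbb{T}$ (a rotation by angle $\theta$ corresponds to $e^{i\theta}$), with the distance between two rotations being the length of the shorter arc of $\mathbb{T}$ between the corresponding points; the topology on $\Gamma_2$ is that of this metric. For $\gamma\in\Gamma_2$ the $\gamma$-rotated basis is $B(\gamma)(x)=\{x+\gamma(R-x): R\in B(x)\}$. A set $E\subset\Gamma_2$ is a $W_B$-set if there exists $f\in L(\mathbb{R}^2)$ such that (1) $f\notin F_{B(\gamma)}$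 for every $\gamma\in E$, and (2) $f\in F_{B(\gamma)}$ for every $\gamma\notin E$. *)

(* Defs.v *)
From HB Require Import structures.
From mathcomp Require Import all_boot all_order all_algebra.
From mathcomp Require Import all_classical all_reals all_analysis.
Set Implicit Arguments. Unset Strict Implicit. Unset Printing Implicit Defensive.
Import Order.TTheory GRing.Theory Num.Theory.
Import numFieldNormedType.Exports.
Local Open Scope classical_set_scope.
Local Open Scope ring_scope.

Section Defs.
Context {R : realType}.

(** Points of R^2. *)
Definition pt := (R * R)%type.

(** Two-dimensional Lebesgue measure: the completion (Caratheodory extension)
    of the product of one-dimensional Lebesgue measures. *)
Definition leb2 :=
  @completed_measure_extension _ _ _
    ((@lebesgue_measure R) \x (@lebesgue_measure R))%E.

(** The measurable space of Lebesgue measurable subsets of R^2. *)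
Definition plane : measurableType _ :=
  caratheodory_type
    (((@lebesgue_measure R) \x (@lebesgue_measure R))%E^*)%mu.

Definition padd (x y : pt) : pt := (x.1 + y.1, x.2 + y.2).
Definition psub (x y : pt) : pt := (x.1 - y.1, x.2 - y.2).

(** Euclidean distance on R^2. *)
Definition edist (x y : pt) : R := Num.sqrt ((x.1 - y.1) ^+ 2 + (x.2 - y.2) ^+ 2).

(** Diameter of a set (in the extended reals). *)
Definition diam (A : set pt) : \bar R :=
  ereal_sup [set e | exists p q, A p /\ A q /\ e = (edist p q)%:E].

Definition pbounded (A : set pt) : Prop :=
  exists M : R, forall p, A p -> edist p (0, 0) <= M.

(** Mean value of f over A. *)
Definition avg (f : pt -> R) (A : set pt) : \bar R :=
  ((fine (leb2 (A : set plane)))^-1)%:E *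
  (\int[leb2]_(x in (A : set plane)) (f x)%:E)%E.

(** Differentiation basis in R^2. *)
Definition diff_basis (B : pt -> set (set pt)) : Prop :=
  forall x : pt,
    (forall A, B x A ->
       [/\ pbounded A, measurable (A : set plane),
           (0 < leb2 (A : set plane))%E & A x]) /\
    exists S : nat -> set pt,
      (forall k, B x (S k)) /\ ((fun k => diam (S k)) @ \oo --> 0%E).

Definition transl_invariant (B : pt -> set (set pt)) : Prop :=
  forall x : pt, B x = [set [set padd x a | a in A0] | A0 in B (0, 0)].

(** Upper and lower derivatives of the integral of f at x w.r.t. B:
    limsup / liminf of avg f R as R ranges over B x with diam R -> 0. *)
Definition upper_der (B : pt -> set (set pt)) (f : pt -> R) (x : pt) : \bar R :=
  ereal_inf [set ereal_sup [set avg f A | A in [set A | B x A /\ (diam A < d%:E)%E]]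
            | d in [set d : R | 0 < d]].

Definition lower_der (B : pt -> set (set pt)) (f : pt -> R) (x : pt) : \bar R :=
  ereal_sup [set ereal_inf [set avg f A | A in [set A | B x A /\ (diam A < d%:E)%E]]
            | d in [set d : R | 0 < d]].

Definition integrable2 (f : pt -> R) : Prop :=
  leb2.-integrable (setT : set plane) (EFin \o f).

(** B differentiates the integral of f (f in F_B). *)
Definition differentiates (B : pt -> set (set pt)) (f : pt -> R) : Prop :=
  {ae leb2, forall x : plane,
      upper_der B f x = (f x)%:E /\ lower_der B f x = (f x)%:E}.

(** Gamma_2: rotations of R^2 about the origin, identified with points
    (cos t, sin t) of the unit circle. *)
Definition rotation := {p : R * R | p.1 ^+ 2 + p.2 ^+ 2 = 1}.

Definition rot_app (g : rotation) (v : pt) : pt :=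
  let c := (sval g).1 in let s := (sval g).2 in
  (c * v.1 - s * v.2, s * v.1 + c * v.2).

(** Length of the shorter arc of T between the two points. *)
Definition arcdist (g h : rotation) : R :=
  acos ((sval g).1 * (sval h).1 + (sval g).2 * (sval h).2).

Definition rot_open (U : set rotation) : Prop :=
  forall g, U g -> exists e : R, 0 < e /\ forall h, arcdist g h < e -> U h.

Definition G_delta_sigma (E : set rotation) : Prop :=
  exists F : nat -> nat -> set rotation,
    (forall i j, rot_open (F i j)) /\ E = \bigcup_i \bigcap_j F i j.

(** gamma-rotated basis: B(gamma)(x) = { x + gamma (R - x) : R in B(x) }. *)
Definition rot_basis (B : pt -> set (set pt)) (g : rotation) : pt -> set (set pt) :=
  fun x => [set [set padd x (rot_app g (psub y x)) | y in A] | A in B x].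

Definition W_set (B : pt -> set (set pt)) (E : set rotation) : Prop :=
  exists f : pt -> R, integrable2 f /\
    (forall g, E g -> ~ differentiates (rot_basis B g) f) /\
    (forall g, ~ E g -> differentiates (rot_basis B g) f).

End Defs.

(* Main.v *)
Require Import Defs.
From HB Require Import structures.
From mathcomp Require Import all_boot all_order all_algebra.
From mathcomp Require Import all_classical all_reals all_analysis.
From mathcomp Require Import measurable_realfun ring lra.
Set Implicit Arguments. Unset Strict Implicit. Unset Printing Implicit Defensive.
Import Order.TTheory GRing.Theory Num.Theory.
Import numFieldNormedType.Exports.
Local Open Scope classical_set_scope.
Local Open Scope ring_scope.

(* For a fixed set A in B(0) the mean of f over x + g A depends continuously
   on (g, x): rigid motions preserve Lebesgue measure, and the measure of the
   symmetric difference of two rigid images of A tends to 0 as the motions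
   approach each other (the sets with the latter property form a sigma-algebra
   which contains half planes). So, for each k and q, the set of the (g, x) such
   that some A with diam A < 1/k has mean > q over x + g A is open. Since
   lower_der <= upper_der, differentiation of f by B(g) fails at x iff
   upper_der f > f or upper_der (- f) > - f at x. Hence f is not differentiated
   by B(g) iff, for f or - f, some rational q and some N, the x in [-N, N]^2
   with f x < q that lie in all these open sets have positive measure. The open
   sets decrease with k, so this says that for some m the measure is > 1/m at
   every stage k, and measure > 1/m is an open condition on g. *)

(** * Measure-preserving affine maps *)

Section ProductMeasure.
Context {R : realType}.
Local Notation mR := (measurableTypeR R).
Local Notation mu1 := (@lebesgue_measure R).
Local Notation mu2 := (mu1 \x mu1)%E.

(** By uniqueness of Lebesgue measure: the pushforward along the translation is a measure that gives
    each half-open interval its length. *)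
Lemma lebesgue_measure_preimage_addr (a : R) (X : set mR) : measurable X ->
  mu1 ((fun y => y + a) @^-1` X) = mu1 X.
Proof.
move=> mX.
have mf : measurable_fun [set: mR] ((fun y : mR => y + a) : mR -> mR).
  exact: measurable_funD.
pose m : {measure set mR -> \bar R} := measure_function_pushforward__canonical__measure_function_Measure mu1 mf.
apply/esym; apply: (@lebesgue_measure_unique R m) => // _ [[u v] _ <-] /=.
rewrite /m /= /pushforward /=.
have -> : (fun y : R => y + a) @^-1` `]u, v]%classic = `]u - a, v - a]%classic.
  by apply/seteqP; split => y /=; rewrite !in_itv /= ltrBlDr lerBrDr.
rewrite !lebesgue_measure_itv /= !lte_fin ltrD2r.
by case: ifP => // _; rewrite -!EFinB opprB addrA subrK.
Qed.

(** Only product-measurable sets are tested here; outer measures later carry the property over to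
    the completed measure. *)
Definition preserves (T : mR * mR -> mR * mR) := forall X, measurable X ->
  measurable (T @^-1` X) /\ mu2 (T @^-1` X) = mu2 X.

Lemma preserves_comp S T : preserves S -> preserves T -> preserves (S \o T).
Proof.
move=> pS pT X /pS[mX <-]; rewrite comp_preimage.
by have [? ->] := pT _ mX.
Qed.

(** By uniqueness of the product measure: the pushforward along the swap has the right value on
    rectangles. *)
Lemma preserves_swap : preserves (fun p => (p.2, p.1)).
Proof.
have ms : measurable_fun setT (fun p : mR * mR => (p.2, p.1)).
  by apply: measurable_fun_pair; [exact: measurable_snd|exact: measurable_fst].
move=> X mX; split; first by rewrite -[X in measurable X]setTI; exact: ms.
pose m : {measure set (mR * mR) -> \bar R} :=
  measure_function_pushforward__canonical__measure_function_Measure mu2 ms.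
apply/esym; apply: (@product_measure_unique _ _ _ _ _ _ _ m) => // A B mA mB.
rewrite /m /= /pushforward /=.
have -> : (fun p : mR * mR => (p.2, p.1)) @^-1` (A `*` B) = B `*` A.
  by apply/seteqP; split => -[x y] [].
by rewrite product_measure1E// muleC.
Qed.

(** Cavalieri's principle: the vertical section at abscissa [x] is translated by [h x], and the
    product measure integrates the lengths of these sections. *)
Lemma preserves_translate2 (h : mR -> mR) : measurable_fun setT h ->
  preserves (fun p => (p.1, p.2 + h p.1)).
Proof.
move=> mh X mX.
have mT : measurable_fun setT (fun p : mR * mR => (p.1, (p.2 : mR) + h p.1) : mR * mR).
  apply: measurable_fun_pair; first exact: measurable_fst.
  apply: measurable_funD; first exact: measurable_snd.
  by apply: (measurableT_comp mh); exact: measurable_fst.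
split; first by rewrite -[X in measurable X]setTI; exact: mT.
rewrite /product_measure1; apply: eq_integral => x _ /=.
rewrite -(lebesgue_measure_preimage_addr (h x) (measurable_xsection x mX)).
congr (mu1 _); apply/seteqP; split => y /=; rewrite /xsection /= !inE //.
Qed.

Lemma preserves_ext S T : S =1 T -> preserves S -> preserves T.
Proof. by move=> /funext ->. Qed.

Lemma preserves_shear2 (a b : R) : preserves (fun p => (p.1, p.2 + (a * p.1 + b))).
Proof.
apply: (@preserves_translate2 (fun x => a * x + b)).
apply: measurable_funD => //; exact: measurable_funM.
Qed.

Lemma preserves_shear1 (a b : R) : preserves (fun p => (p.1 + (a * p.2 + b), p.2)).
Proof.
apply: (@preserves_ext ((fun p => (p.2, p.1)) \o
  ((fun p => (p.1, p.2 + (a * p.1 + b))) \o (fun p => (p.2, p.1))))) => //.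
apply: preserves_comp; first exact: preserves_swap.
apply: preserves_comp; [exact: preserves_shear2|exact: preserves_swap].
Qed.

(* For [c != -1] the rotation by t is the product of the shears with
   coefficients - tan (t / 2), sin t, - tan (t / 2). *)
Lemma preserves_rotation (c s : R) : c ^+ 2 + s ^+ 2 = 1 ->
  preserves (fun p => (c * p.1 - s * p.2, s * p.1 + c * p.2)).
Proof.
wlog cN1 : c s / c + 1 != 0 => [wl|] cs.
  have [|c1] := eqVneq (c + 1) 0; last exact: wl.
  move=> /eqP; rewrite addr_eq0 => /eqP c1.
  have s0 : s = 0.
    by apply/eqP; rewrite -sqrf_eq0; move: cs; rewrite c1 => cs; apply/eqP; lra.
  (* The excluded case is the half turn, the square of the quarter turn, for which [c + 1] is
     nonzero. *)
  have q : preserves (fun p => (0 * p.1 - 1 * p.2, 1 * p.1 + 0 * p.2)).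
    by apply: wl; [rewrite add0r oner_neq0|rewrite expr0n add0r expr1n].
  apply: preserves_ext (preserves_comp q q) => -[x y] /=.
  by rewrite c1 s0; congr pair; ring.
set t := - (s / (c + 1)).
apply: (@preserves_ext ((fun p => (p.1 + (t * p.2 + 0), p.2)) \o
  ((fun p => (p.1, p.2 + (s * p.1 + 0))) \o
   (fun p => (p.1 + (t * p.2 + 0), p.2))))); last first.
  apply: preserves_comp; first exact: preserves_shear1.
  by apply: preserves_comp; [exact: preserves_shear2|exact: preserves_shear1].
have ts : t * s = c - 1.
  have -> : t * s = - (s ^+ 2) / (c + 1) by rewrite /t; field.
  have -> : s ^+ 2 = (1 - c) * (c + 1) by lra.
  by field.
have tc : t * (c + 1) = - s by rewrite /t; field.
have e1 (x y : R) :
  x + (t * y + 0) + (t * (y + (s * (x + (t * y + 0)) + 0)) + 0) = c * x - s * y.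
  rewrite [LHS](_ : _ = x + (t * s) * x + ((t * s) * t + 2 * t) * y); last by ring.
  rewrite ts (_ : (c - 1) * t + 2 * t = t * (c + 1)); last by ring.
  by rewrite tc; ring.
have e2 (x y : R) : y + (s * (x + (t * y + 0)) + 0) = s * x + c * y.
  rewrite [LHS](_ : _ = s * x + (1 + t * s) * y); last by ring.
  by rewrite ts; ring.
by move=> [x y] /=; rewrite e1 e2.
Qed.

Lemma preserves_rigid (c s a b : R) : c ^+ 2 + s ^+ 2 = 1 ->
  preserves (fun p => (c * p.1 - s * p.2 + a, s * p.1 + c * p.2 + b)).
Proof.
move=> cs; apply: (@preserves_ext ((fun p => (p.1, p.2 + (0 * p.1 + b))) \o
  ((fun p => (p.1 + (0 * p.2 + a), p.2)) \o
   (fun p => (c * p.1 - s * p.2, s * p.1 + c * p.2))))).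
  by move=> [x y] /=; rewrite !mul0r !add0r.
apply: preserves_comp; first exact: preserves_shear2.
by apply: preserves_comp; [exact: preserves_shear1|exact: preserves_rotation].
Qed.

End ProductMeasure.

(** * Completed Lebesgue measure of the plane under rigid motions *)

Section PlaneMeasure.
Context {R : realType}.
Local Notation mR := (measurableTypeR R).
Local Notation mu1 := (@lebesgue_measure R).
Local Notation mu2 := (mu1 \x mu1)%E.
Local Notation plane := (@plane R).

Lemma le_leb2 (A B : set plane) : A `<=` B -> (leb2 A <= leb2 B)%E.
Proof. exact: (@le_outer_measure R _ (mu2^*)%mu). Qed.

Lemma leb2U (A B : set plane) : (leb2 (A `|` B) <= leb2 A + leb2 B)%E.
Proof. exact: (outer_measureU2 (mu2^*)%mu). Qed.

Lemma measurable_prod_plane (A : set (mR * mR)) :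
  measurable A -> measurable (A : set plane).
Proof. exact: caratheodory_measurable_mu_ext. Qed.

Lemma leb2_prod (A : set (mR * mR)) :
  measurable A -> leb2 (A : set plane) = mu2 A.
Proof. exact: measurable_mu_extE. Qed.

Lemma measurable_planeP (A : set plane) : measurable A <->
  forall X : set plane, (leb2 X = leb2 (X `&` A) + leb2 (X `&` ~` A))%E.
Proof.
have -> : measurable A = caratheodory_measurable (mu2^*)%mu A by [].
by split => mA X; exact: (mA X).
Qed.

(** [leb2] is an infimum over countable covers by product-measurable sets, and the preimages of a
    cover of [A] form a cover of the preimage with the same total measure. *)
Lemma leb2_preimage_le (T : @pt R -> @pt R) (A : set plane) : preserves T ->
  (leb2 ((T @^-1` A) : set plane) <= leb2 A)%E.
Proof.
move=> pT; apply: le_ereal_inf_tmp => _ [F [mF AF] <-].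
apply: ereal_inf_lbound; exists (fun n => T @^-1` F n).
  split; first by move=> n; exact: (pT _ (mF n)).1.
  by move=> p /AF [n _ ?]; exists n.
by apply: eq_eseriesr => n _; exact: (pT _ (mF n)).2.
Qed.

Section Bijection.
Variables T T' : @pt R -> @pt R.
Hypotheses (TK : cancel T T') (T'K : cancel T' T).
Hypotheses (pT : preserves T) (pT' : preserves T').

Let preimageK (A : set plane) : T' @^-1` (T @^-1` A) = A.
Proof. by apply/seteqP; split => p /=; rewrite T'K. Qed.

Let preimageK' (A : set plane) : T @^-1` (T' @^-1` A) = A.
Proof. by apply/seteqP; split => p /=; rewrite TK. Qed.

Lemma leb2_preimage (A : set plane) : leb2 ((T @^-1` A) : set plane) = leb2 A.
Proof.
apply/eqP; rewrite eq_le leb2_preimage_le//=.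
by rewrite -{1}(preimageK A); exact: leb2_preimage_le.
Qed.

(** Each test set [X] in Caratheodory's criterion is the preimage of a test set for [A], and
    [leb2_preimage] makes the two splittings agree. *)
Lemma measurable_plane_preimage (A : set plane) :
  measurable A -> measurable ((T @^-1` A) : set plane).
Proof.
move=> /measurable_planeP mA; apply/measurable_planeP => X.
rewrite -[X]preimageK'; have := mA (T' @^-1` X).
rewrite -(leb2_preimage (T' @^-1` X)) -(leb2_preimage (_ `&` A)).
by rewrite -(leb2_preimage (_ `&` ~` A)).
Qed.

End Bijection.

Definition mot (g : @rotation R) (x y : @pt R) : @pt R := padd x (rot_app g y).

(** The inverse of [mot g x]: the transposed rotation matrix applied to [y - x]. It turns images
    under a rigid motion into preimages. *)
Definition imot (g : @rotation R) (x y : @pt R) : @pt R :=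
  ((sval g).1 * (y.1 - x.1) + (sval g).2 * (y.2 - x.2),
   (sval g).1 * (y.2 - x.2) - (sval g).2 * (y.1 - x.1)).

Lemma rotationE (g : @rotation R) : (sval g).1 ^+ 2 + (sval g).2 ^+ 2 = 1.
Proof. exact: svalP g. Qed.

Lemma motK g x : cancel (mot g x) (imot g x).
Proof.
case: x => x1 x2 [y1 y2]; rewrite /mot /imot /padd /rot_app /=.
have := rotationE g; set c := (sval g).1; set s := (sval g).2 => cs.
congr pair.
  by rewrite [LHS](_ : _ = (c ^+ 2 + s ^+ 2) * y1); [rewrite cs mul1r|ring].
by rewrite [LHS](_ : _ = (c ^+ 2 + s ^+ 2) * y2); [rewrite cs mul1r|ring].
Qed.

Lemma imotK g x : cancel (imot g x) (mot g x).
Proof.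
case: x => x1 x2 [y1 y2]; rewrite /mot /imot /padd /rot_app /=.
have := rotationE g; set c := (sval g).1; set s := (sval g).2 => cs.
congr pair.
  by rewrite [LHS](_ : _ = x1 + (c ^+ 2 + s ^+ 2) * (y1 - x1)); [rewrite cs|]; ring.
by rewrite [LHS](_ : _ = x2 + (c ^+ 2 + s ^+ 2) * (y2 - x2)); [rewrite cs|]; ring.
Qed.

Lemma preserves_mot g x : preserves (mot g x).
Proof.
apply: preserves_ext (preserves_rigid x.1 x.2 (rotationE g)) => -[y1 y2].
by rewrite /mot /padd /rot_app /= !(addrC _ x.1) !(addrC _ x.2).
Qed.

Lemma preserves_imot g x : preserves (imot g x).
Proof.
have cs : (sval g).1 ^+ 2 + (- (sval g).2) ^+ 2 = 1 by rewrite sqrrN rotationE.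
apply: preserves_ext (preserves_rigid
  (- ((sval g).1 * x.1 + (sval g).2 * x.2))
  ((sval g).2 * x.1 - (sval g).1 * x.2) cs) => -[y1 y2].
by rewrite /imot /=; congr pair; ring.
Qed.

Lemma mot_imageE g x (A : set (@pt R)) : mot g x @` A = imot g x @^-1` A.
Proof.
apply/seteqP; split => [_ [y Ay <-]|y Ay] /=; first by rewrite motK.
by exists (imot g x y) => //; rewrite imotK.
Qed.

Lemma leb2_imot g x (A : set plane) :
  leb2 ((imot g x @^-1` A) : set plane) = leb2 A.
Proof.
exact: (leb2_preimage (@motK g x) (@preserves_imot g x) (@preserves_mot g x)).
Qed.

Lemma measurable_imot g x (A : set plane) :
  measurable A -> measurable ((imot g x @^-1` A) : set plane).
Proof.
exact: (measurable_plane_preimage (@imotK g x) (@motK g x) (@preserves_imot g x)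
  (@preserves_mot g x)).
Qed.

End PlaneMeasure.

(** * Nearby rigid motions *)

Section Nearby.
Context {R : realType}.
Implicit Types (g : @rotation R) (x : @pt R).

(** The neighbourhoods of [(g0, x0)], with rotations compared through their coordinates on the
    circle; [arcdist_close] relates these to the arc distance. *)
Definition nearby g0 x0 (P : @rotation R -> @pt R -> Prop) :=
  exists2 e : R, 0 < e & forall g x,
    [/\ `|(sval g).1 - (sval g0).1| < e, `|(sval g).2 - (sval g0).2| < e,
        `|x.1 - x0.1| < e & `|x.2 - x0.2| < e] -> P g x.

Lemma nearbyS g0 x0 (P Q : @rotation R -> @pt R -> Prop) :
  (forall g x, P g x -> Q g x) -> nearby g0 x0 P -> nearby g0 x0 Q.
Proof. by move=> PQ [e e0 H]; exists e => // g x /H /PQ. Qed.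

Lemma nearbyI g0 x0 (P Q : @rotation R -> @pt R -> Prop) :
  nearby g0 x0 P -> nearby g0 x0 Q -> nearby g0 x0 (fun g x => P g x /\ Q g x).
Proof.
move=> [e e0 HP] [d d0 HQ]; exists (Num.min e d); first by rewrite lt_min e0.
move=> g x; rewrite !lt_min.
by move=> [/andP[? ?] /andP[? ?] /andP[? ?] /andP[? ?]]; split; [apply: HP|apply: HQ].
Qed.

Lemma rotation_le1 g : `|(sval g).1| <= 1 /\ `|(sval g).2| <= 1.
Proof.
have := rotationE g; set c := (sval g).1; set s := (sval g).2 => cs.
by split; rewrite -(@expr_le1 _ 2)// real_normK ?num_real// -cs ?lerDl ?lerDr sqr_ge0.
Qed.

Definition box (M : R) : set (@plane R) := [set y | `|y.1| <= M /\ `|y.2| <= M].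

Lemma ler_norm_rotation (a b u v M N : R) : `|a| <= 1 -> `|b| <= 1 ->
  `|u| <= M -> `|v| <= N -> `|a * u + b * v| <= M + N.
Proof.
move=> a1 b1 uM vN; rewrite (le_trans (ler_normD _ _))// !normrM lerD//.
  by rewrite -[leRHS]mul1r ler_pM.
by rewrite -[leRHS]mul1r ler_pM.
Qed.

(** One box serves for all nearby motions, so later estimates take place in a set of finite
    measure. *)
Lemma imot_box g0 x0 M : exists M', nearby g0 x0 (fun g x =>
  box M `<=` imot g x @^-1` box M').
Proof.
exists ((M + (`|x0.1| + 1)) + (M + (`|x0.2| + 1))); exists 1 => // g x [_ _ h1 h2].
have k1 : `|x.1| <= `|x0.1| + 1.
  by rewrite -(subrK x0.1 x.1) (le_trans (ler_normD _ _))// addrC lerD2l ltW.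
have k2 : `|x.2| <= `|x0.2| + 1.
  by rewrite -(subrK x0.2 x.2) (le_trans (ler_normD _ _))// addrC lerD2l ltW.
have [c1 s1] := rotation_le1 g.
move=> y [y1 y2] /=.
have u1 : `|y.1 - x.1| <= M + (`|x0.1| + 1).
  by rewrite (le_trans (ler_normB _ _))// lerD.
have u2 : `|y.2 - x.2| <= M + (`|x0.2| + 1).
  by rewrite (le_trans (ler_normB _ _))// lerD.
split; rewrite /imot /=; first exact: ler_norm_rotation.
by rewrite -mulNr addrC ler_norm_rotation// normrN.
Qed.

Lemma mot_box g0 x0 M : exists M', nearby g0 x0 (fun g x =>
  mot g x @` box M `<=` box M').
Proof.
exists ((`|x0.1| + 1) + (`|x0.2| + 1) + (M + M)); exists 1 => // g x [_ _ h1 h2].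
have k1 : `|x.1| <= `|x0.1| + 1.
  by rewrite -(subrK x0.1 x.1) (le_trans (ler_normD _ _))// addrC lerD2l ltW.
have k2 : `|x.2| <= `|x0.2| + 1.
  by rewrite -(subrK x0.2 x.2) (le_trans (ler_normD _ _))// addrC lerD2l ltW.
have [c1 s1] := rotation_le1 g.
move=> _ [y [y1 y2] <-]; split; rewrite /mot /padd /rot_app /=.
  rewrite (le_trans (ler_normD _ _))// lerD//.
    by rewrite (le_trans k1)// lerDl addr_ge0.
  by rewrite -mulNr ler_norm_rotation// normrN.
rewrite (le_trans (ler_normD _ _))// lerD//.
  by rewrite (le_trans k2)// lerDr addr_ge0.
exact: ler_norm_rotation.
Qed.

Lemma imot_cont g0 x0 M (e : R) : 0 < e -> nearby g0 x0 (fun g x => forall y,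
  box M y -> `|(imot g x y).1 - (imot g0 x0 y).1| <= e /\
             `|(imot g x y).2 - (imot g0 x0 y).2| <= e).
Proof.
move=> e0.
(* With [S] the sum of the three absolute values, the two changed matrix entries contribute at most
   [2 * d * S] and the shifted point at most [2 * d]; [K] dominates [2 * S + 2]. *)
pose K := 2 * (`|M| + `|x0.1| + `|x0.2| + 2).
have K0 : 0 < K by rewrite mulr_gt0// ltr_wpDl// !addr_ge0.
exists (e / K); first by rewrite divr_gt0.
set d := e / K; have d0 : 0 <= d by rewrite ltW// divr_gt0.
move=> g x [hc hs h1 h2] y [y1 y2].
have [c1 s1] := rotation_le1 g.
have -> : e = d * K by rewrite /d divfK// gt_eqF.
have M0 : M <= `|M| := ler_norm M.
have ux : `|y.1 - x0.1| <= `|M| + `|x0.1|.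
  by rewrite (le_trans (ler_normB _ _))// lerD// (le_trans y1).
have uy : `|y.2 - x0.2| <= `|M| + `|x0.2|.
  by rewrite (le_trans (ler_normB _ _))// lerD// (le_trans y2).
have key (a b a0 b0 u v : R) : `|a - a0| <= d -> `|b - b0| <= d ->
    `|a| <= 1 -> `|b| <= 1 ->
    `|u| <= `|M| + `|x0.1| + `|x0.2| -> `|v| <= `|M| + `|x0.1| + `|x0.2| ->
    forall u' v', `|u' - u| <= d -> `|v' - v| <= d ->
    `|(a * u' + b * v') - (a0 * u + b0 * v)| <= d * K.
  move=> ha hb a1 b1 hu hv u' v' hu' hv'.
  rewrite [X in `|X|](_ : _ = ((a - a0) * u + (b - b0) * v) +
     (a * (u' - u) + b * (v' - v))); last by ring.
  rewrite (le_trans (ler_normD _ _))//.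
  have := ler_norm_rotation a1 b1 hu' hv'.
  have := ler_normD ((a - a0) * u) ((b - b0) * v).
  rewrite !normrM.
  have := ler_pM (normr_ge0 _) (normr_ge0 _) ha hu.
  have := ler_pM (normr_ge0 _) (normr_ge0 _) hb hv.
  by rewrite /K; lra.
have B1 : `|y.1 - x0.1| <= `|M| + `|x0.1| + `|x0.2| by rewrite ler_wpDr.
have B2 : `|y.2 - x0.2| <= `|M| + `|x0.1| + `|x0.2|.
  by rewrite addrAC ler_wpDr.
have D1 : `|(y.1 - x.1) - (y.1 - x0.1)| <= d.
  by rewrite distrC opprB addrC subrKA ltW.
have D2 : `|(y.2 - x.2) - (y.2 - x0.2)| <= d.
  by rewrite distrC opprB addrC subrKA ltW.
split; rewrite /imot /=.
  by apply: key => //; exact: ltW.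
have ns : `|- (sval g).2 - (- (sval g0).2)| <= d.
  by rewrite -opprD normrN ltW.
rewrite -2!mulNr; apply: key => //; first exact: ltW.
by rewrite normrN.
Qed.

End Nearby.

(** * Rigid images of a measurable set *)

Section RigidContinuity.
Context {R : realType}.
Local Notation mR := (measurableTypeR R).
Local Notation mu1 := (@lebesgue_measure R).
Local Notation mu2 := (mu1 \x mu1)%E.
Local Notation plane := (@plane R).

Definition symd (A B : set plane) : set plane := (A `\` B) `|` (B `\` A).

Lemma symdC (A B : set plane) : symd (~` A) (~` B) = symd A B.
Proof.
apply/seteqP; split => y /=; rewrite /symd /=; have [] := pselect (A y);
  have [] := pselect (B y); tauto.
Qed.

Lemma box_prod (M : R) :
  box M = (`[- M, M]%classic `*` `[- M, M]%classic : set plane).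
Proof. by apply/seteqP; split => y; rewrite /box /= !in_itv /= !ler_norml. Qed.

Lemma measurable_box (M : R) : measurable (box M).
Proof. by rewrite box_prod; apply: measurable_prod_plane; exact: measurableX. Qed.

Lemma leb2_rect (a b c d : R) : a <= b -> c <= d ->
  leb2 (`[a, b]%classic `*` `[c, d]%classic : set plane) = ((b - a) * (d - c))%:E.
Proof.
move=> ab cd; rewrite leb2_prod; last exact: measurableX.
rewrite product_measure1E//= !lebesgue_measure_itv /= !lte_fin.
move: ab cd; rewrite !le_eqVlt => /orP[/eqP->|->]; rewrite ?ltxx ?subrr ?mul0e ?mul0r//.
by move=> /orP[/eqP->|->]; rewrite ?ltxx ?subrr ?mule0 ?mulr0.
Qed.

Lemma leb2_box_fin (M : R) : (leb2 (box M) < +oo)%E.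
Proof.
apply: (@le_lt_trans _ _ (leb2 (box `|M|))).
  apply: le_leb2 => y [h1 h2].
  by split; [apply: le_trans h1 _|apply: le_trans h2 _]; rewrite ler_norm.
by rewrite box_prod leb2_rect ?ltry// -subr_ge0 opprK addr_ge0.
Qed.

(** The restriction to a box is essential for half planes: two rotated ones can differ by a set of
    infinite measure. *)
Definition rigid_cont (A : set plane) := measurable A /\
  forall g0 x0 M (e : R), 0 < e -> nearby g0 x0 (fun g x =>
    (leb2 (box M `&` symd (imot g x @^-1` A) (imot g0 x0 @^-1` A)) < e%:E)%E).

Lemma rigid_contC A : rigid_cont A -> rigid_cont (~` A).
Proof.
move=> [mA cA]; split; first exact: measurableC.
move=> g0 x0 M e e0; apply: nearbyS (cA g0 x0 M _ e0) => g x.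
by rewrite -(symdC (imot g x @^-1` A) (imot g0 x0 @^-1` A)).
Qed.

Lemma rigid_contU A B : rigid_cont A -> rigid_cont B -> rigid_cont (A `|` B).
Proof.
move=> [mA cA] [mB cB]; split; first exact: measurableU.
move=> g0 x0 M e e0; have e2 : 0 < e / 2 by rewrite divr_gt0.
apply: nearbyS (nearbyI (cA g0 x0 M _ e2) (cB g0 x0 M _ e2)) => g x [hA hB].
rewrite (splitr e) EFinD (le_lt_trans _ (lteD hA hB))//.
rewrite (le_trans _ (leb2U _ _))//; apply: le_leb2 => y /= [hy].
rewrite /symd /=; tauto.
Qed.

Lemma leb2_set0 : leb2 (set0 : set plane) = 0%E.
Proof. exact: measure0. Qed.

Lemma rigid_cont0 : rigid_cont set0.
Proof.
split; first exact: measurable0.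
move=> g0 x0 M e e0; exists 1 => // g x _.
by rewrite !preimage_set0 /symd setDv setU0 setI0 leb2_set0 lte_fin.
Qed.

(** A finite union [F n] replaces the whole union up to a tail that is small in a bounded box, by
    continuity of the measure from above. The tail keeps its measure under every motion, hence a
    three-term estimate. *)
Lemma rigid_cont_bigcup (A : nat -> set plane) :
  (forall n, rigid_cont (A n)) -> rigid_cont (\bigcup_n A n).
Proof.
move=> cA; pose F n := \big[setU/set0]_(i < n) A i.
have cF n : rigid_cont (F n).
  rewrite /F; elim: n => [|n IH]; first by rewrite big_ord0; exact: rigid_cont0.
  by rewrite big_ord_recr /=; exact: rigid_contU.
have mU : measurable (\bigcup_n A n) by apply: bigcup_measurable => n _; exact: (cA n).1.
split => // g0 x0 M e e0.
have [M' hM'] := imot_box g0 x0 M.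
pose G n := box M' `&` (\bigcup_k A k `\` F n).
have mG n : measurable (G n).
  by apply: measurableI; [exact: measurable_box|apply: measurableD => //; exact: (cF n).1].
have G0 : \bigcap_n G n = set0.
  apply/seteqP; split => // y Gy.
  have [_ [[k _ Aky] _]] := Gy 0%N I.
  (* [F n] stops before index [n], so [A k] is first contained in [F k.+1]. *)
  by have [_ [_]] := Gy k.+1 I; apply; rewrite /F big_ord_recr /=; right.
have niG : nonincreasing_seq G.
  move=> m n mn; apply/subsetPset; apply: setIS; apply: setDS.
  by rewrite /F; apply: subset_bigsetU.
have G0fin : (leb2 (G 0%N) < +oo)%E.
  by apply: le_lt_trans (leb2_box_fin M'); apply: le_leb2; exact: subIsetl.
have e3 : 0 < e / 3 by rewrite divr_gt0.
have [n Gn] : exists n, (leb2 (G n) < (e / 3)%:E)%E.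
  have mI : measurable (\bigcap_n G n) by rewrite G0; exact: measurable0.
  have : (fun n => leb2 (G n)) @ \oo --> 0%E.
    by rewrite -leb2_set0 -G0; exact: nonincreasing_cvg_mu.
  move=> /fine_cvgP[Gf /cvgr_lt /(_ _ e3) Glt].
  have [n _ H] : \forall n \near \oo, (leb2 (G n) < (e / 3)%:E)%E.
    near=> n; rewrite -[leb2 _]fineK ?lte_fin; by near: n.
  by exists n; apply: H => /=.
apply: nearbyS (nearbyI ((cF n).2 g0 x0 M _ e3) hM') => g x [hF hb].
have hb0 : box M `<=` imot g0 x0 @^-1` box M'.
  case: hM' => d d0; apply; by rewrite !subrr normr0.
have S : box M `&` symd (imot g x @^-1` (\bigcup_n A n)) (imot g0 x0 @^-1` (\bigcup_n A n))
  `<=` (box M `&` symd (imot g x @^-1` F n) (imot g0 x0 @^-1` F n)) `|`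
     ((imot g x @^-1` G n) `|` (imot g0 x0 @^-1` G n)).
  move=> y [by_ sy].
  have FA : F n `<=` \bigcup_n A n.
    by rewrite /F -bigcup_mkord => z [k _ ?]; exists k.
  have := hb _ by_; have := hb0 _ by_ => /= h0 h1.
  have := FA (imot g x y); have := FA (imot g0 x0 y).
  rewrite /G /=; move: sy; rewrite /symd /=.
  move: (pselect (F n (imot g x y))) (pselect (F n (imot g0 x0 y))); tauto.
apply: le_lt_trans (le_leb2 S) _.
apply: le_lt_trans (leb2U _ _) _.
have -> : e = e / 3 + (e / 3 + e / 3) by field.
rewrite EFinD lteD//; apply: le_lt_trans (leb2U _ _) _.
by rewrite EFinD lteD// leb2_imot.
Unshelve. all: by end_near. Qed.

(** If just one of two close points lies in the half plane where [f] is at most [a], then both have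
    [f] close to [a]. So the symmetric difference sits in the preimage of a thin strip. The
    hypotheses are those satisfied by the two coordinates. *)
Lemma rigid_cont_strip (f : @pt R -> R) :
  measurable_fun (setT : set (mR * mR)) f ->
  (forall p q e, `|p.1 - q.1| <= e -> `|p.2 - q.2| <= e -> `|f p - f q| <= e) ->
  (forall M a e, 0 < M -> 0 < e ->
     (leb2 (box M `&` [set p | (`|f p - a| <= e)%R]) <= (4 * M * e)%:E)%E) ->
  forall a, rigid_cont (f @^-1` `]-oo, a]%classic).
Proof.
move=> mf lf sf a; split.
  apply: measurable_prod_plane; rewrite -[X in measurable X]setTI; exact: mf.
move=> g0 x0 M e e0.
have [M' hM'] := imot_box g0 x0 M.
have hb0 : box M `<=` imot g0 x0 @^-1` box (`|M'| + 1).
  case: hM' => d d0 H y /H h.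
  have [] : (imot g0 x0 @^-1` box M') y by apply: h; rewrite !subrr normr0.
  by move=> k1 k2; split; [apply: le_trans k1 _|apply: le_trans k2 _];
    rewrite ler_wpDr ?ler_norm.
have M1 : 0 < `|M'| + 1 by rewrite ltr_wpDl.
(* This width makes the strip bound equal to [e / 2], leaving room for the strict inequality;
   [|M'| + 1] is a positive size of box whatever the sign of [M']. *)
pose d := e / 2 / (4 * (`|M'| + 1)).
have d0 : 0 < d by rewrite !divr_gt0// mulr_gt0.
apply: nearbyS (imot_cont g0 x0 M d0) => g x hc.
apply: (@le_lt_trans _ _ (e / 2)%:E); last first.
  by rewrite lte_fin gtr_pMr// invf_lt1 ?ltr1n.
have -> : e / 2 = 4 * (`|M'| + 1) * d by rewrite /d [RHS]mulrC divfK// gt_eqF// mulr_gt0.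
apply: le_trans (sf _ a _ M1 d0).
rewrite -(leb2_imot g0 x0 (box (`|M'| + 1) `&` _)); apply: le_leb2 => y [by_ sy].
split; first exact: hb0.
have [h1 h2] := hc y by_.
have := lf _ _ _ h1 h2; move: sy; rewrite /symd /= !in_itv /=.
set u := f _; set v := f _ => sy uv.
have {sy} : (u <= a) && (a < v) \/ (v <= a) && (a < u).
  by case: sy => -[-> /negP]; rewrite -ltNge => ->; [left|right].
case=> /andP[k1 k2]; move: uv; rewrite !ler_norml => /andP[? ?]; apply/andP; split; lra.
Qed.

End RigidContinuity.

(** * From half planes to product-measurable sets, then to bounded Lebesgue measurable sets *)

Section MeasurableRigidContinuity.
Context {R : realType}.
Local Notation mR := (measurableTypeR R).
Local Notation mu1 := (@lebesgue_measure R).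
Local Notation mu2 := (mu1 \x mu1)%E.
Local Notation plane := (@plane R).

Lemma rigid_cont_fst (a : R) :
  rigid_cont ((@fst R R) @^-1` `]-oo, a]%classic).
Proof.
apply: rigid_cont_strip => [|//|M b e M0 e0]; first exact: measurable_fst.
apply: (@le_trans _ _
  (leb2 (`[b - e, b + e]%classic `*` `[- M, M]%classic : set plane))).
  apply: le_leb2 => y [[_ y2] /= y1]; split => /=; rewrite in_itv /=.
    by rewrite -ler_distl.
  by rewrite -ler_norml.
rewrite leb2_rect ?lee_fin; first by rewrite le_eqVlt; apply/orP; left; apply/eqP; ring.
- by lra.
- by lra.
Qed.

Lemma rigid_cont_snd (a : R) :
  rigid_cont ((@snd R R) @^-1` `]-oo, a]%classic).
Proof.
apply: rigid_cont_strip => [|//|M b e M0 e0]; first exact: measurable_snd.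
apply: (@le_trans _ _
  (leb2 (`[- M, M]%classic `*` `[b - e, b + e]%classic : set plane))).
  apply: le_leb2 => y [[y2 _] /= y1]; split => /=; rewrite in_itv /=.
    by rewrite -ler_norml.
  by rewrite -ler_distl.
rewrite leb2_rect ?lee_fin; first by rewrite le_eqVlt; apply/orP; left; apply/eqP; ring.
- by lra.
- by lra.
Qed.

(** The sets [X] with this property form a sigma-algebra, which contains the generating intervals
    []a, b]] as differences of two rays. *)
Lemma rigid_cont_preimage (f : @pt R -> R) :
  (forall a, rigid_cont (f @^-1` `]-oo, a]%classic)) ->
  forall X : set mR, measurable X -> rigid_cont (f @^-1` X).
Proof.
move=> cf X mX.
have : [set Y : set mR | rigid_cont (f @^-1` Y)] X; last by [].
move: X mX; apply: smallest_sub.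
  split => /=.
  - by rewrite preimage_set0; exact: rigid_cont0.
  - by move=> A cA; rewrite setTD; exact: rigid_contC.
  - by move=> F cF; rewrite preimage_bigcup; exact: rigid_cont_bigcup.
move=> _ [[a b] _ <-] /=.
have -> : f @^-1` `]a, b]%classic =
    ~` (f @^-1` `]-oo, a]%classic `|` ~` (f @^-1` `]-oo, b]%classic)).
  apply/seteqP; split => y /=; rewrite !in_itv /=.
    by move=> /andP[ay yb]; rewrite leNgt ay yb; case.
  move=> H; apply/andP; split; last by apply: contrapT => ?; apply: H; right.
  by rewrite ltNge; apply/negP => ?; apply: H; left.
by apply/rigid_contC/rigid_contU => //; exact: rigid_contC.
Qed.

(** The product sigma-algebra is generated by preimages under the two coordinates. *)
Lemma rigid_cont_measurable (A : set (mR * mR)) :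
  measurable A -> rigid_cont (A : set plane).
Proof.
move=> mA; have : [set Y : set (mR * mR) | rigid_cont (Y : set plane)] A; last by [].
move: A mA; apply: smallest_sub.
  split => /=.
  - exact: rigid_cont0.
  - by move=> A cA; rewrite setTD; exact: rigid_contC.
  - by move=> F cF; exact: rigid_cont_bigcup.
move=> A [] [X mX <-]; rewrite setTI.
  by apply: rigid_cont_preimage mX => a; exact: rigid_cont_fst.
by apply: rigid_cont_preimage mX => a; exact: rigid_cont_snd.
Qed.

(** A cover nearly optimal for the outer measure gives a product-measurable [G] around [A] with
    little excess. Boundedness of [A] keeps all nearby images in one box, so no box remains in the
    conclusion. *)
Lemma symd_image_cont (A : set plane) g0 x0 (M e : R) :
  measurable A -> A `<=` box M -> 0 < e -> nearby g0 x0 (fun g x =>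
    (leb2 (symd (mot g x @` A) (mot g0 x0 @` A)) < e%:E)%E).
Proof.
move=> mA AM e0.
have e3 : 0 < e / 3 by rewrite divr_gt0.
have Afin : (leb2 A < +oo)%E by apply: le_lt_trans (leb2_box_fin M); exact: le_leb2.
have Afn : leb2 A \is a fin_num by rewrite ge0_fin_numE.
have [G [mG AG GA]] : exists G : set (mR * mR), [/\ measurable G, A `<=` G &
    (leb2 ((G `\` A) : set plane) < (e / 3)%:E)%E].
  have [_ [F [mF AF] <-] HF] :
      exists2 y, [set (\sum_(k <oo) mu2 (F k))%E | F in measurable_cover (A : set (mR * mR))] y &
        (y < leb2 A + (e / 3)%:E)%E.
    exact: (@lb_ereal_inf_adherent R _ (e / 3) e3 Afn).
  exists (\bigcup_k F k); split => //.
    by apply: bigcup_measurable => k _; exact: mF.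
  have mU : measurable (\bigcup_k F k : set plane).
    by apply: measurable_prod_plane; apply: bigcup_measurable => k _; exact: mF.
  have UF : (leb2 (\bigcup_k F k : set plane) < leb2 A + (e / 3)%:E)%E.
    apply: le_lt_trans HF.
    apply: le_trans (outer_measure_sigma_subadditive (mu2^*)%mu F) _.
    rewrite le_eqVlt; apply/orP; left; apply/eqP.
    by apply: eq_eseriesr => k _; exact: leb2_prod (mF k).
  have -> : leb2 ((\bigcup_k F k `\` A) : set plane) =
      (leb2 (\bigcup_k F k : set plane) - leb2 A)%E.
    transitivity (leb2 (\bigcup_k F k : set plane) -
                  leb2 ((\bigcup_k F k : set plane) `&` A))%E.
      apply: measureD => //; apply: lt_trans UF _.
      by rewrite -(fineK Afn) -EFinD ltry.
    by rewrite (setIidr AF).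
  by rewrite lteBlDr// addeC.
have [M' hM'] := mot_box g0 x0 M.
apply: nearbyS (nearbyI ((rigid_cont_measurable mG).2 g0 x0 M' _ e3) hM') => g x [hG hb].
have hb0 : mot g0 x0 @` box M `<=` box M'.
  by case: hM' => d d0; apply; rewrite !subrr normr0.
rewrite !mot_imageE in hb hb0 *.
(* A point where the images of [A] differ is one where the images of [G] differ, unless it falls in
   the excess [G \ A] for one of the motions. *)
have S : symd (imot g x @^-1` A) (imot g0 x0 @^-1` A) `<=`
    (box M' `&` symd (imot g x @^-1` G) (imot g0 x0 @^-1` G)) `|`
     ((imot g x @^-1` (G `\` A)) `|` (imot g0 x0 @^-1` (G `\` A))).
  move=> y.
  have := hb y; have := hb0 y => /= h0 h1.
  have := AM (imot g x y); have := AM (imot g0 x0 y).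
  have := AG (imot g x y); have := AG (imot g0 x0 y).
  rewrite /symd /=.
  move: (pselect (G (imot g x y))) (pselect (G (imot g0 x0 y))); tauto.
apply: le_lt_trans (le_leb2 S) _.
apply: le_lt_trans (leb2U _ _) _.
have -> : e = e / 3 + (e / 3 + e / 3) by field.
rewrite EFinD lteD//; apply: le_lt_trans (leb2U _ _) _.
by rewrite EFinD lteD// leb2_imot.
Qed.

End MeasurableRigidContinuity.

(** * Continuity of averages *)

Section IntegralContinuity.
Context d (T : measurableType d) (R : realType) (mu : {measure set T -> \bar R}).
Variable f : T -> R.
Hypothesis intf : mu.-integrable setT (EFin \o f).

Let intS A : measurable A -> mu.-integrable A (EFin \o f).
Proof. by move=> mA; apply: integrableS intf. Qed.

Lemma Rintegral_setID (A B : set T) : measurable A -> measurable B ->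
  \int[mu]_(x in A) f x = \int[mu]_(x in A `&` B) f x + \int[mu]_(x in A `\` B) f x.
Proof.
move=> mA mB; rewrite -Rintegral_setU ?setUIDK//.
- exact: measurableI.
- exact: measurableD.
- exact: intS.
- by apply/disj_setPS => x [[_ ?] [_ ?]].
Qed.

(** The integrals over the common part cancel; absolute continuity of the integral bounds the two
    differences. *)
Lemma Rintegral_set_cont (e : R) : 0 < e -> exists2 d : R, 0 < d &
  forall A B, measurable A -> measurable B ->
    (mu (A `\` B) < d%:E)%E -> (mu (B `\` A) < d%:E)%E ->
    `|\int[mu]_(x in A) f x - \int[mu]_(x in B) f x| < e.
Proof.
move=> e0; have [|r [r0 H]] := @integral_normr_continuous _ _ _ _ _ intf (e / 2).
  by rewrite divr_gt0.
exists r => // A B mA mB AB BA.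
have mAB := measurableD mA mB; have mBA := measurableD mB mA.
rewrite (Rintegral_setID mA mB) (Rintegral_setID mB mA) (setIC B A).
rewrite opprD addrACA subrr add0r (le_lt_trans (ler_normB _ _))// (splitr e) ltrD//.
  by rewrite (le_lt_trans (le_normr_Rintegral _ _))//; [exact: intS|exact: H].
by rewrite (le_lt_trans (le_normr_Rintegral _ _))//; [exact: intS|exact: H].
Qed.

End IntegralContinuity.

(** * Averages over rigid images of a bounded set *)

Section Averages.
Context {R : realType}.
Local Notation plane := (@plane R).

Lemma pbounded_box (A : set (@pt R)) : pbounded A -> exists M, A `<=` box M.
Proof.
move=> [M HM]; exists M => y /HM; rewrite /Defs.edist /= !subr0 => h.
split; apply: le_trans h; rewrite -sqrtr_sqr ler_sqrt ?addr_ge0 ?sqr_ge0//.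
  by rewrite lerDl sqr_ge0.
by rewrite lerDr sqr_ge0.
Qed.

Lemma avgE (f : @pt R -> R) (A : set plane) : integrable2 f -> measurable A ->
  avg f A = ((fine (leb2 A))^-1 * \int[leb2]_(x in A) f x)%:E.
Proof.
move=> fint mA; rewrite EFinM /Rintegral fineK//.
by apply: integrable_fin_num => //; apply: integrableS fint => //; exact: measurableT.
Qed.

Lemma avgN (f : @pt R -> R) (A : set plane) : integrable2 f -> measurable A ->
  avg (fun x => - f x) A = (- avg f A)%E.
Proof.
move=> fint mA; rewrite /avg -muleN; congr (_ * _)%E.
have intA : leb2.-integrable A (EFin \o f).
  by apply: integrableS fint => //; exact: measurableT.
rewrite -integralN; last exact: (integrable_add_def mA intA).
by apply: eq_integral => x _.
Qed.

(** Rigid motions keep the denominator of the mean fixed, so only the integral varies, and it varies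
    little because the symmetric difference is small. *)
Lemma avg_cont (f : @pt R -> R) (A : set plane) g0 x0 (q : R) :
  integrable2 f -> measurable A -> pbounded A ->
  (q%:E < avg f (mot g0 x0 @` A))%E ->
  nearby g0 x0 (fun g x => (q%:E < avg f (mot g x @` A))%E).
Proof.
move=> fint mA /pbounded_box[M AM].
(* Division is by [a + 1] because [a] vanishes when [A] is null, the inverse of 0 being 0. *)
have key (a I I0 : R) : 0 <= a -> `|I - I0| < (a * I0 - q) / (a + 1) -> q < a * I.
  move=> a0; rewrite ltr_pdivlMr; last by rewrite ltr_wpDl.
  move=> h.
  have h1 : I0 - I <= `|I - I0| by rewrite distrC ler_norm.
  have := ler_wpM2l a0 h1; have := normr_ge0 (I - I0).
  by move: h; rewrite mulrBr mulrDr mulr1 (mulrC `|_|); lra.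
have mm g x : measurable (mot g x @` A : set plane).
  by rewrite mot_imageE; exact: measurable_imot.
have mE g x : leb2 (mot g x @` A : set plane) = leb2 A.
  by rewrite mot_imageE leb2_imot.
rewrite avgE // mE lte_fin.
set a := (fine _)^-1; set I0 := (\int[leb2]_(x in _) _) => qa.
have a0 : 0 <= a by rewrite invr_ge0 fine_ge0.
have a1 : 0 < a + 1 by rewrite ltr_wpDl.
have e0 : 0 < (a * I0 - q) / (a + 1).
  by rewrite divr_gt0 ?subr_gt0.
have [r r0 H] := Rintegral_set_cont fint e0.
apply: nearbyS (symd_image_cont g0 x0 mA AM r0) => g x sr.
rewrite avgE // mE lte_fin -/a.
apply: (key _ _ I0) => //; apply: H => //; apply: le_lt_trans sr; apply: le_leb2.
  exact: subsetUl.
exact: subsetUr.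
Qed.

End Averages.

(** * Open sets of rotations *)

Section RotationOpen.
Context {R : realType}.
Local Notation plane := (@plane R).

Lemma lt_norm_sqr (v e : R) : 0 < e -> v ^+ 2 < e ^+ 2 -> `|v| < e.
Proof.
move=> e0 h; rewrite ltNge; apply/negP => ev.
by have := real_normK (num_real v); nra.
Qed.

(** The squared chord is [2 - 2 * u], where [u] is the cosine of the arc distance; continuity of the
    cosine at 0 makes it less than [e ^+ 2]. *)
Lemma arcdist_close (g : @rotation R) (e : R) : 0 < e ->
  exists2 d : R, 0 < d & forall h, arcdist g h < d ->
    `|(sval h).1 - (sval g).1| < e /\ `|(sval h).2 - (sval g).2| < e.
Proof.
move=> e0; have e2 : 0 < e ^+ 2 / 2 by rewrite divr_gt0// exprn_gt0.
have /cvgrPdist_lt /(_ _ e2) [d /= d0 H] := @continuous_cos R 0.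
exists d => // h; rewrite /arcdist.
have := rotationE g; have := rotationE h.
set c := (sval g).1; set s := (sval g).2; set c' := (sval h).1; set s' := (sval h).2.
move=> hh hg; set u := c * c' + s * s' => ud.
have ku : (c' - c) ^+ 2 + (s' - s) ^+ 2 = 2 - 2 * u.
  rewrite [LHS](_ : _ = (c' ^+ 2 + s' ^+ 2) + (c ^+ 2 + s ^+ 2) - 2 * u).
    by rewrite hh hg; ring.
  by rewrite /u; ring.
have ku' : (c' + c) ^+ 2 + (s' + s) ^+ 2 = 2 + 2 * u.
  rewrite [LHS](_ : _ = (c' ^+ 2 + s' ^+ 2) + (c ^+ 2 + s ^+ 2) + 2 * u).
    by rewrite hh hg; ring.
  by rewrite /u; ring.
(* This range is what allows [cos (acos u)] to be rewritten as [u]. *)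
have u1 : -1 <= u <= 1.
  have := sqr_ge0 (c' - c); have := sqr_ge0 (s' - s).
  have := sqr_ge0 (c' + c); have := sqr_ge0 (s' + s).
  move: ku ku'; clear; clearbody u c s c' s' => ku ku' *.
  by apply/andP; split; lra.
have : 1 - u < e ^+ 2 / 2.
  have := H (acos u); rewrite /= sub0r normrN ger0_norm ?acos_ge0//.
  move=> /(_ ud); rewrite cos0 acosK ?in_itv//=.
  by apply: le_lt_trans; exact: ler_norm.
move=> ue; have su : (c' - c) ^+ 2 + (s' - s) ^+ 2 < e ^+ 2 by rewrite ku; lra.
split; apply: lt_norm_sqr => //.
  by apply: le_lt_trans su; rewrite lerDl sqr_ge0.
by apply: le_lt_trans su; rewrite lerDr sqr_ge0.
Qed.

(** * Families of plane sets that are open jointly in the rotation and the point *)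

Section OpenFamily.
Variable O : @rotation R -> set plane.
Hypothesis openO : forall g x, O g x -> nearby g x (fun h y => O h y).

Let square (a b : R) (k : nat) : set plane :=
  [set y | `|y.1 - a| < k.+1%:R^-1 /\ `|y.2 - b| < k.+1%:R^-1].

Let measurable_square a b k : measurable (square a b k).
Proof.
rewrite (_ : square a b k = (ball a k.+1%:R^-1 `*` ball b k.+1%:R^-1)).
  by apply: measurable_prod_plane; apply: measurableX; exact: measurable_ball.
by apply/seteqP; split => y; rewrite /square /ball /= /ball_ /= !(distrC _ y.1) !(distrC _ y.2).
Qed.

(* Countably many rational squares, each of which stays in [O h] for all [h]
   in a neighbourhood of [g], cover [O g]. *)
Let V (g : @rotation R) (n : nat) : set plane :=
  if @unpickle (rat * rat * nat)%type n is Some (a, b, k) then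
    [set y | square (ratr a) (ratr b) k y /\
      forall h, `|(sval h).1 - (sval g).1| < k.+1%:R^-1 ->
        `|(sval h).2 - (sval g).2| < k.+1%:R^-1 ->
        square (ratr a) (ratr b) k `<=` O h]
  else set0.

Let measurable_V g n : measurable (V g n).
Proof.
rewrite /V; case: unpickle => [[[a b] k]|]; last exact: measurable0.
(* The stability condition does not mention the point [y], so the set is the whole square or
   empty. *)
set P := forall h, _; have [p|np] := pselect P.
  rewrite (_ : [set y | _] = square (ratr a) (ratr b) k).
    exact: measurable_square.
  by apply/seteqP; split => y //= [].
rewrite (_ : [set y | _] = set0); first exact: measurable0.
by apply/seteqP; split => y //= [].
Qed.

Let bigcup_V g : \bigcup_n V g n = O g.
Proof.
apply/seteqP; split => [x [n _]|x Ox].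
  rewrite /V; case: unpickle => [[[a b] k]|] // [sx]; apply => //; rewrite subrr normr0 //.
have [e e0 He] := openO Ox.
(* Half of [e], since [x] and another point of the square are compared through its centre. *)
have [k] : exists k : nat, 0 + k.+1%:R^-1 < e / 2 by apply: ltr_add_invr; rewrite divr_gt0.
rewrite add0r => ke.
have rat_near (u r : R) : 0 < r -> exists q : rat, ratr q \in `]u - r, u + r[.
  by move=> r0; apply: rat_in_itvoo; rewrite ltrBlDr -addrA ltrDl addr_gt0.
have k0 : 0 < k.+1%:R^-1 :> R by rewrite invr_gt0.
have [a] := rat_near x.1 _ k0.
rewrite in_itv /= -ltr_distl => xa.
have [b] := rat_near x.2 _ k0.
rewrite in_itv /= -ltr_distl => xb.
have := pickleK (a, b, k); move: (pickle _) => n nE.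
exists n => //; rewrite /V nE; split.
  by rewrite /square /= distrC (distrC x.2).
move=> h h1 h2 y [y1 y2]; apply: He.
have le : k.+1%:R^-1 < e by rewrite (lt_trans ke)// gtr_pMr// invf_lt1// ltr1n.
split; [exact: lt_trans h1 le|exact: lt_trans h2 le| |].
  rewrite -(subrK (ratr a) y.1) -addrA (le_lt_trans (ler_normD _ _))//.
  by rewrite (splitr e) ltrD// (lt_trans _ ke).
rewrite -(subrK (ratr b) y.2) -addrA (le_lt_trans (ler_normD _ _))//.
by rewrite (splitr e) ltrD// (lt_trans _ ke).
Qed.

Lemma measurable_open_family g : measurable (O g).
Proof. by rewrite -bigcup_V; apply: bigcup_measurable => n _; exact: measurable_V. Qed.

Let V_stable g N : exists2 e : R, 0 < e & forall h,
  `|(sval h).1 - (sval g).1| < e -> `|(sval h).2 - (sval g).2| < e ->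
  \big[setU/set0]_(i < N) V g i `<=` O h.
Proof.
elim: N => [|N [e e0 IH]]; first by exists 1 => // h _ _; rewrite big_ord0.
have [d d0 Hd] : exists2 d : R, 0 < d & forall h,
    `|(sval h).1 - (sval g).1| < d -> `|(sval h).2 - (sval g).2| < d ->
    V g N `<=` O h.
  rewrite /V; case: unpickle => [[[a b] k]|]; last first.
    by exists 1 => // h _ _; exact: sub0set.
  exists k.+1%:R^-1; first by rewrite invr_gt0.
  by move=> h h1 h2 y [sy]; apply.
exists (Num.min e d); first by rewrite lt_min e0.
move=> h; rewrite !lt_min => /andP[? ?] /andP[? ?].
by rewrite big_ord_recr /= subUset; split; [exact: IH|exact: Hd].
Qed.

(** By continuity from below, finitely many of the squares covering [O g] already give measure above
    [m], and these finitely many stay inside [O h] for all [h] close to [g]. *)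
Lemma rot_open_measure (S : set plane) (m : R) : measurable S ->
  rot_open [set g | (m%:E < leb2 (S `&` O g))%E].
Proof.
move=> mS g /=; pose F N := S `&` \big[setU/set0]_(i < N.+1) V g i.
have mF N : measurable (F N).
  by apply: measurableI => //; apply: bigsetU_measurable => i _; exact: measurable_V.
have FE : \bigcup_N F N = S `&` O g.
  by rewrite -setI_bigcupr bigcup_bigsetU_bigcup bigcup_V.
have ndF : nondecreasing_seq F.
  by move=> i j ij; apply/subsetPset; apply: setIS; exact: subset_bigsetU.
rewrite -FE => mlt.
have [N mN] : exists N, (m%:E < leb2 (F N))%E.
  apply: contrapT => /forallNP H.
  have : (leb2 (\bigcup_N F N) <= m%:E)%E.
    have cF : leb2 (F N) @[N --> \oo] --> leb2 (\bigcup_N F N).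
      by apply: nondecreasing_cvg_mu => //; exact: bigcup_measurable.
    have /cvg_lim <- // := cF.
    apply: lime_le; first by apply/cvg_ex; eexists; exact: cF.
    by apply: nearW => N; rewrite leNgt; apply/negP.
  by rewrite leNgt mlt.
have [e e0 He] := V_stable g N.+1.
have [d d0 Hd] := arcdist_close g e0.
exists d; split => // h /Hd[h1 h2]; apply: lt_le_trans mN _.
by apply: le_leb2; apply: setIS; exact: He.
Qed.

End OpenFamily.
End RotationOpen.

(** * Differentiation with respect to rotated bases *)

(** Continuity from above: the intersection has positive measure exactly when the decreasing
    measures stay above some [1 / (m + 1)]. This yields the countable union of countable
    intersections. *)
Lemma bigcap_measure_eq0 d (T : measurableType d) (R : realType)
    (mu : {measure set T -> \bar R}) (X : nat -> set T) :
  (forall k, measurable (X k)) -> nonincreasing_seq X -> (mu (X 0%N) < +oo)%E ->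
  mu (\bigcap_k X k) = 0%E <->
  ~ exists m : nat, forall k, ((m.+1%:R^-1 : R)%:E < mu (X k))%E.
Proof.
move=> mX niX X0.
have mI : measurable (\bigcap_k X k) by exact: bigcap_measurable.
have cX := nonincreasing_cvg_mu X0 mX mI niX.
split=> [mu0 [m Hm]|H].
  move: cX; rewrite mu0 => /cvg_lim => /(_ (@ereal_hausdorff R)) l0.
  have : ((m.+1%:R^-1 : R)%:E <= limn (mu \o X))%E.
    apply: lime_ge; last by apply: nearW => k; apply: ltW; exact: Hm.
    by apply: ereal_nonincreasing_is_cvgn => i j ij; apply: le_measure;
      rewrite ?inE//; apply/subsetPset/niX.
  by rewrite l0 lee_fin leNgt invr_gt0 ltr0n.
apply: contrapT => mu0; apply: H.
have fin : mu (\bigcap_k X k) \is a fin_num.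
  rewrite ge0_fin_numE//; apply: le_lt_trans X0; apply: le_measure; rewrite ?inE//.
  exact: bigcap_inf.
have [m] : exists m : nat, 0 + m.+1%:R^-1 < fine (mu (\bigcap_k X k)).
  by apply: ltr_add_invr; rewrite fine_gt0// lt0e measure_ge0 andbT -ge0_fin_numE// fin andbT; apply/eqP.
rewrite add0r -lte_fin fineK// => Hm; exists m => k; apply: lt_le_trans Hm _.
by apply: le_measure; rewrite ?inE//; exact: bigcap_inf.
Qed.

Section RotatedBasis.
Context {R : realType} (B : @pt R -> set (set (@pt R))).
Local Notation plane := (@plane R).
Hypotheses (basisB : diff_basis B) (translB : transl_invariant B).
Implicit Types (f : @pt R -> R) (g : @rotation R) (x : @pt R).

(** Translation invariance enters here: the sets at every [x] and [g] are indexed by the single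
    family [B (0, 0)], so one [A] can be followed as the motion varies. *)
Lemma rot_basisE g x : rot_basis B g x = [set mot g x @` A | A in B (0, 0)].
Proof.
have psubK (y : @pt R) : psub (padd x y) x = y.
  by case: y => y1 y2; rewrite /psub /padd /= !(addrC x.1) !(addrC x.2) !addrK.
rewrite /rot_basis translB; apply/seteqP; split => [_ [_ [A BA <-] <-]|_ [A BA <-]].
  exists A => //; apply/seteqP; split => [_ [y Ay <-]|_ [_ [y Ay <-] <-]].
    by exists (padd x y); [exists y|rewrite psubK].
  by exists y => //; rewrite psubK.
exists [set padd x a | a in A]; first by exists A.
apply/seteqP; split => [_ [_ [y Ay <-] <-]|_ [y Ay <-]].
  by exists y => //; rewrite psubK.
by exists (padd x y); [exists y|rewrite psubK].
Qed.

Lemma diam_mot g x (A : set (@pt R)) : diam (mot g x @` A) = diam A.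
Proof.
have ed p q : Defs.edist (mot g x p) (mot g x q) = Defs.edist p q.
  rewrite /Defs.edist /mot /padd /rot_app /=; congr Num.sqrt.
  have := rotationE g; set c := (sval g).1; set s := (sval g).2 => cs.
  transitivity ((c ^+ 2 + s ^+ 2) * ((p.1 - q.1) ^+ 2 + (p.2 - q.2) ^+ 2)).
    by ring.
  by rewrite cs mul1r.
rewrite /diam; congr ereal_sup; apply/seteqP; split => e.
  by move=> [_ [_ [[p Ap <-] [[q Aq <-] ->]]]]; exists p, q; rewrite ed.
by move=> [p [q [Ap [Aq ->]]]]; exists (mot g x p), (mot g x q);
  rewrite ed; split; [exists p|split => //; exists q].
Qed.

Lemma measurable_basis A g x : B (0, 0) A -> measurable (mot g x @` A : set plane).
Proof.
move=> /(basisB (0, 0)).1[_ mA _ _].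
by rewrite mot_imageE; exact: measurable_imot.
Qed.

Definition large_avg f (k : nat) (q : R) g : set plane :=
  [set x | exists A, [/\ B (0, 0) A, (diam A < (k.+1%:R^-1)%:E)%E &
                         (q%:E < avg f (mot g x @` A))%E]].

Lemma large_avg_open f k q g x : integrable2 f -> large_avg f k q g x ->
  nearby g x (fun h y => large_avg f k q h y).
Proof.
move=> fint [A [BA dA qA]]; have [bA mA _ _] := (basisB (0, 0)).1 A BA.
by apply: nearbyS (avg_cont fint mA bA qA) => h y ?; exists A.
Qed.

Lemma large_avg_lt_upper f q g x : (q%:E < upper_der (rot_basis B g) f x)%E ->
  forall k, large_avg f k q g x.
Proof.
move=> qu k.
have /ereal_sup_gt[_ [A' [BA' dA] <-] qA] : (q%:E < ereal_sup [set avg f A |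
    A in [set A | rot_basis B g x A /\ (diam A < (k.+1%:R^-1)%:E)%E]])%E.
  apply: lt_le_trans qu _; apply: ereal_inf_lbound; exists k.+1%:R^-1 => //.
  by rewrite /= invr_gt0.
move: BA'; rewrite rot_basisE => -[A BA AE].
by exists A; split => //; [rewrite -(diam_mot g x) AE|rewrite AE].
Qed.

(** The infimum over scales preserves only a weak inequality; [above] regains strictness from a
    rational strictly larger than [f x]. *)
Lemma le_upper_der f q g x : (forall k, large_avg f k q g x) ->
  (q%:E <= upper_der (rot_basis B g) f x)%E.
Proof.
move=> H; apply: le_ereal_inf_tmp => _ [d /= d0 <-].
have [k] : exists k : nat, 0 + k.+1%:R^-1 < d by exact: ltr_add_invr.
rewrite add0r => kd; have [A [BA dA qA]] := H k.
apply: le_trans (ltW qA) _; apply: ereal_sup_ubound; exists (mot g x @` A) => //.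
split; first by rewrite rot_basisE; exists A.
by rewrite diam_mot (lt_trans dA)// lte_fin.
Qed.

Definition above f g : set plane :=
  [set x | exists q : rat, f x < ratr q /\ forall k, large_avg f k (ratr q) g x].

Lemma aboveP f g x :
  above f g x <-> ((f x)%:E < upper_der (rot_basis B g) f x)%E.
Proof.
split=> [[q [fq /le_upper_der]]|]; first by apply: lt_le_trans; rewrite lte_fin.
case E : (upper_der _ _ _) => [r||] // h.
  have [q] := rat_in_itvoo h; rewrite in_itv /= => /andP[fq qr].
  by exists q; split => //; apply: large_avg_lt_upper; rewrite E lte_fin.
(* The upper derivative is [+oo]: any rational above [f x] serves, and [f x + 1] merely bounds the
   interval. *)
have [q] : exists q : rat, ratr q \in `]f x, f x + 1[ by apply: rat_in_itvoo; rewrite ltrDl.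
rewrite in_itv /= => /andP[fq qr].
by exists q; split => //; apply: large_avg_lt_upper; rewrite E ltry.
Qed.

Lemma lower_der_oppr f g x : integrable2 f ->
  lower_der (rot_basis B g) f x = (- upper_der (rot_basis B g) (fun y => (- f y)%R) x)%E.
Proof.
move=> fint; rewrite /lower_der /upper_der -ereal_supN image_comp.
congr ereal_sup; apply: eq_imagel => d _ /=.
rewrite -ereal_infN image_comp; congr ereal_inf.
apply: eq_imagel => A [+ _]; rewrite rot_basisE => -[A0 BA0 <-] /=.
by rewrite avgN ?oppeK//; exact: measurable_basis.
Qed.

(** The basis has sets of arbitrarily small diameter, so at any two scales some set enters both the
    infimum and the supremum. *)
Lemma le_lower_upper_der f g x :
  (lower_der (rot_basis B g) f x <= upper_der (rot_basis B g) f x)%E.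
Proof.
apply: le_ereal_inf_tmp => _ [d /= d0 <-]; apply: ge_ereal_sup => _ [d' /= d'0 <-].
have [S [BS /fine_cvgP[Sfin /cvgr_lt Slt]]] := (basisB (0, 0)).2.
have m0 : 0 < Num.min d d' by rewrite lt_min d0.
have [k [Sk1 Sk2]] : exists k, (diam (S k) < d%:E)%E /\ (diam (S k) < d'%:E)%E.
  have [n _ H] : \forall n \near \oo, (diam (S n) < (Num.min d d')%:E)%E.
    near=> n; rewrite -[diam _]fineK; last by near: n.
    by rewrite lte_fin; near: n; exact: Slt.
  have := H n (leqnn n); rewrite EFin_min lt_min => /andP[? ?].
  by exists n.
have BSk : rot_basis B g x (mot g x @` S k) by rewrite rot_basisE; exists (S k).
apply: (@le_trans _ _ (avg f (mot g x @` S k))).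
  by apply: ereal_inf_lbound; exists (mot g x @` S k) => //; split;
    rewrite ?diam_mot.
by apply: ereal_sup_ubound; exists (mot g x @` S k) => //; split;
    rewrite ?diam_mot.
Unshelve. all: by end_near. Qed.

Lemma integrable2N f : integrable2 f -> integrable2 (fun y => - f y).
Proof. by move=> fint; exact: (integrableN fint). Qed.

(** Since the lower derivative is at most the upper one, both equal [f x] unless the upper one
    exceeds [f x] or the lower one is below it; the latter is the former for [- f]. *)
Lemma differentiatesP f g : integrable2 f -> differentiates (rot_basis B g) f <->
  leb2.-negligible (above f g) /\ leb2.-negligible (above (fun y => - f y) g).
Proof.
move=> fint.
have E : ~` [set x : plane | upper_der (rot_basis B g) f x = (f x)%:E /\
    lower_der (rot_basis B g) f x = (f x)%:E] =
    above f g `|` above (fun y => - f y) g.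
  apply/seteqP; split => x /=.
    move=> H; apply: contrapT => /not_orP[/aboveP H1 /aboveP H2]; apply: H.
    move/negP: H1; rewrite -leNgt => H1.
    move/negP: H2; rewrite -leNgt EFinN leeNr -lower_der_oppr// => H2.
    have H3 := le_lower_upper_der f g x.
    by split; apply/eqP; rewrite eq_le ?H1 ?H2 ?andbT /=;
      [exact: le_trans H2 H3|exact: le_trans H3 H1].
  case=> /aboveP H [E1 E2]; first by rewrite E1 ltxx in H.
  by move: H; rewrite EFinN lteNl -lower_der_oppr// E2 ltxx.
have -> : differentiates (rot_basis B g) f =
    leb2.-negligible (above f g `|` above (fun y => - f y) g) by rewrite -E.
split=> [H|[]]; last exact: negligibleU.
by split; apply: negligibleS H; [exact: subsetUl|exact: subsetUr].
Qed.

(** The box gives finite measure, as continuity from above requires. *)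
Definition sublevel f (q : R) (N : nat) : set plane :=
  box N%:R `&` [set x | f x < q].

Lemma measurable_sublevel f q N : integrable2 f -> measurable (sublevel f q N).
Proof.
move=> fint; apply: measurableI; first exact: measurable_box.
have /measurable_EFinP mf := measurable_int _ fint.
rewrite (_ : [set x | _] = setT `&` f @^-1` `]-oo, q[%classic).
  by apply: mf => //; exact: measurableT.
by rewrite setTI; apply/seteqP; split => y /=; rewrite in_itv.
Qed.

(** [above f g] is a countable union, over [q] and [N], of decreasing intersections over the scale
    [k]; it is not negligible exactly when one of these has positive measure. *)
Lemma not_negligible_aboveP f g : integrable2 f ->
  ~ leb2.-negligible (above f g) <-> exists (q : rat) (N m : nat), forall k,
    ((m.+1%:R^-1)%:E < leb2 (sublevel f (ratr q) N `&` large_avg f k (ratr q) g))%E.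
Proof.
move=> fint.
pose X q N k := sublevel f (ratr q) N `&` large_avg f k (ratr q) g.
have mX q N k : measurable (X q N k).
  apply: measurableI; first exact: measurable_sublevel.
  by apply: measurable_open_family => ? ?; exact: large_avg_open.
have niX q N : nonincreasing_seq (X q N).
  move=> i j ij; apply/subsetPset; apply: setIS => x [A [BA dA qA]]; exists A.
  split => //; apply: lt_le_trans dA _.
  by rewrite lee_fin lef_pV2 ?posrE// ler_nat.
have X0 q N : (leb2 (X q N 0%N) < +oo)%E.
  apply: le_lt_trans (leb2_box_fin N%:R); apply: le_leb2.
  by move=> x [[]].
have mI q N : measurable (\bigcap_k X q N k) by exact: bigcap_measurable.
have E q N := bigcap_measure_eq0 (mX q N) (niX q N) (X0 q N).
have aboveE : above f g = \bigcup_q \bigcup_N \bigcap_k X q N k.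
  apply/seteqP; split => [x [q [fq H]]|x [q _ [N _ H]]].
    have [N xN] : exists N : nat, `|x.1| + `|x.2| < N%:R.
      by eexists; apply: archi_boundP; rewrite addr_ge0.
    exists q => //; exists N => // k _; split => //; split => //.
    by split; rewrite ltW// (le_lt_trans _ xN)// ?lerDl ?lerDr.
  exists q; split; first by have [[]] := H 0%N I.
  by move=> k; have [] := H k I.
rewrite aboveE; split=> [H|[q [N [m H]]] neg].
  apply: contrapT => H'; apply: H.
  pose Y n := if @unpickle (rat * nat)%type n is Some (q, N)
              then \bigcap_k X q N k else set0.
  apply: (@negligibleS _ _ _ _ (\bigcup_n Y n)).
    move=> x [q _ [N _ Hx]].
    have := pickleK (q, N); move: (pickle _) => n nE.
    by exists n => //; rewrite /Y nE.
  apply: negligible_bigcup => n; rewrite /Y; case: unpickle => [[q N]|].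
    apply/negligibleP => //; apply/E => -[m Hm]; apply: H'.
    by exists q, N, m.
  exact: negligible_set0.
suff : leb2 (\bigcap_k X q N k) = 0%E by move/E; apply; exists m.
apply/negligibleP => //; apply: negligibleS neg => x Hx.
by exists q => //; exists N.
Qed.

Lemma W_set_G_delta_sigma (E : set (@rotation R)) : W_set B E -> G_delta_sigma E.
Proof.
move=> [f [fint [EN Ed]]].
pose sf (b : bool) := if b then f else fun y => - f y.
have isf b : integrable2 (sf b) by case: b => //; exact: integrable2N.
pose G (b : bool) (q : rat) (N m k : nat) := [set g | ((m.+1%:R^-1 : R)%:E <
  leb2 (sublevel (sf b) (ratr q) N `&` large_avg (sf b) k (ratr q) g))%E].
(* The outer index codes the sign, the rational level, the box and the lower bound; the inner index
   is the scale. An index that codes nothing gets the empty set and adds nothing to the union. *)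
exists (fun i j => if @unpickle (bool * rat * nat * nat)%type i is Some (b, q, N, m)
  then G b q N m j else set0); split.
  move=> i j; case: unpickle => [[[[b q] N] m]|] //.
  apply: rot_open_measure; first by move=> ? ?; exact: large_avg_open.
  exact: measurable_sublevel.
apply/seteqP; split=> [g /EN|g [i _]].
  rewrite differentiatesP// => /not_andP H.
  have [b] : exists b, ~ leb2.-negligible (above (sf b) g).
    by case: H => ?; [exists true|exists false].
  move=> /not_negligible_aboveP => /(_ (isf b))[q [N [m H']]].
  have := pickleK (b, q, N, m); move: (pickle _) => n nE.
  by exists n => // k _; rewrite nE; exact: H'.
case: unpickle => [[[[b q] N] m]|] H; last by have := H 0%N I.
apply: contrapT => /Ed; rewrite differentiatesP// => -[H1 H2].
have : ~ leb2.-negligible (above (sf b) g).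
  by apply/not_negligible_aboveP => //; exists q, N, m => k; exact: H.
by case: b {H}.
Qed.

End RotatedBasis.

Theorem theorem2 (R : realType) (B : @pt R -> set (set (@pt R))) :
  diff_basis B -> transl_invariant B ->
  forall E : set (@rotation R), W_set B E -> G_delta_sigma E.
Proof. by move=> basisB translB E; exact: W_set_G_delta_sigma. Qed.
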